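(* Let $\Sigma=(\Gamma,\sigma)$ be a signed graph and let $\lambda,\mu$ be integers with $\lambda\ge\mu\ge0$. Then \[ f(\Sigma,\lambda,\mu)=\sum_{i=0}^{|E(\Gamma)|}(-1)^i\sum_{\substack{Y\subseteq E(\Gamma)\\ |Y|=i}}\lambda^{p(\Sigma|Y)}\,(\lambda-\mu)^{b(\Sigma|Y)-p(\Sigma|Y)}\,\delta^{c(\Sigma|Y)-b(\Sigma|Y)}, \] where $\delta\in\{0,1\}$ is congruent to $\lambda-\mu$ modulo $2$, and $0^0=1$.
   Context: A signed graph $\Sigma=(\Gamma,\sigma)$ is a finite simple graph $\Gamma$ with a signature $\sigma:E(\Gamma)\to\{\pm1\}$. A cycle is negative if it has an odd number of negative edges; a signed graph is balanced if it has no negative cycle. For $Y\subseteq E(\Gamma)$, $\Sigma|Y$ is the spanning signed subgraph $((V(\Gamma),Y),\sigma|_Y)$. For a signed graph $\Lambda$, $c(\Lambda)$ is the number of connected components, $b(\Lambda)$ the number of balanced connected components, and $p(\Lambda)$ the number of connected components all of whose edges are positive (isolated vertices count as all-positive components). Let $\lambda\ge\mu\ge0$ be integers. A finite set $C\subseteq\mathbb Z$ is a $(\lambda,\mu)$-colour set if there are disjoint sets $P,U$ of nonzero integers with $-P=P$, $|U|=\mu$, $(-U)\cap U=\varnothing$, and either $\lambda-\mu$ is even, $|P|=\lambda-\mu$ and $C=P\cup U$, or $\lambda-\mu$ is odd, $|P|=\lambda-\mu-1$ and $C=P\cup U\cup\{0\}$. A proper $C$-colouring of $\Sigma$ is a map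 $\kappa:V(\Gamma)\to C$ with $\kappa(v)\ne\sigma(\{v,w\})\kappa(w)$ for every edge $\{v,w\}$. $f(\Sigma,\lambda,\mu)$ denotes the number of proper $C$-colourings of $\Sigma$ for a $(\lambda,\mu)$-colour set $C$ (this number does not depend on the choice of $C$). *)

(* Defs.v *)
From HB Require Import structures.
From mathcomp Require Import all_boot all_order all_algebra finmap.

Set Implicit Arguments.
Unset Strict Implicit.
Unset Printing Implicit Defensive.

Import Order.TTheory GRing.Theory Num.Theory.
Local Open Scope ring_scope.

(* The vertex set is the whole finite type V; edges are two-element sets of
   vertices. Values of sgn outside the edge set are irrelevant. *)
Record signed_graph (V : finType) := SignedGraph {
  edges : {set {set V}};
  sgn : {set V} -> int;
  edges_card2 : forall e, e \in edges -> #|e| = 2;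
  sgn_pm1 : forall e, e \in edges -> sgn e = 1 \/ sgn e = -1
}.

(* Since P is disjoint from U and symmetric, it is also disjoint from -U. *)
Definition colour_set (lam mu : nat) (C : {fset int}) : Prop :=
  exists P U : {fset int},
    [/\ [disjoint P & U]%fset, 0 \notin P & 0 \notin U] /\
    [/\ [fset - x | x in P]%fset = P, #|` U| = mu
      & [disjoint [fset - x | x in U] & U]%fset] /\
    ([/\ ~~ odd (lam - mu), #|` P| = (lam - mu)%N & C = (P `|` U)%fset] \/
     [/\ odd (lam - mu), #|` P| = (lam - mu - 1)%N
       & C = (P `|` U `|` [fset 0])%fset]).

Lemma colour_set_exists (lam mu : nat) :
  exists C : {fset int}, colour_set lam mu C.
Proof.
set m := (lam - mu)./2.
pose p := [seq Posz i.+1 | i <- iota 0 m] ++ [seq Negz i | i <- iota 0 m].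
pose u := [seq Posz i.+1 | i <- iota m mu].
pose P := [fset x in p]%fset; pose U := [fset x in u]%fset.
have inP x : (x \in P) = (x \in p).
  by apply/imfsetP/idP => [[y /= + ->] //|xp]; exists x.
have inU x : (x \in U) = (x \in u).
  by apply/imfsetP/idP => [[y /= + ->] //|xu]; exists x.
have posI : injective (fun i => Posz i.+1) by move=> i j [].
have negI : injective Negz by move=> i j [].
have pP i : (Posz i.+1 \in p) = (i < m)%N.
  rewrite mem_cat (mem_map posI) mem_iota add0n /=.
  by case: (i < m)%N => //=; apply/negP => /mapP[].
have pN i : (Negz i \in p) = (i < m)%N.
  rewrite mem_cat (mem_map negI) mem_iota add0n /= orbC.
  by case: (i < m)%N => //=; apply/negP => /mapP[].
have p0 : 0 \notin p by rewrite mem_cat; apply/norP; split; apply/negP => /mapP[].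
have u0 : 0 \notin u by apply/negP => /mapP[].
have pS x : (- x \in p) = (x \in p).
  by case: x => [[|i]|i]; rewrite ?oppr0 // (pN, pP) (pN, pP).
have szP : #|` P| = m.*2.
  rewrite card_fseq undup_id ?size_cat ?size_map ?size_iota ?addnn //.
  rewrite cat_uniq !map_inj_uniq // !iota_uniq andbT /=.
  by apply/hasPn => _ /mapP[i _ ->]; apply/negP => /mapP[].
have szU : #|` U| = mu.
  by rewrite card_fseq undup_id ?size_map ?size_iota // map_inj_uniq ?iota_uniq.
have base : [/\ [disjoint P & U]%fset, 0 \notin P & 0 \notin U] /\
    [/\ [fset - x | x in P]%fset = P, #|` U| = mu
      & [disjoint [fset - x | x in U] & U]%fset].
  split; split=> //; rewrite ?inP ?inU //.
  - apply/fdisjointP => x; rewrite inP inU => xp; apply/negP => /mapP[i].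
    by rewrite mem_iota => /andP[le_mi _] ex; move: xp; rewrite ex pP ltnNge le_mi.
  - apply/fsetP => x; rewrite inP; apply/imfsetP/idP => [[y /= + ->]|xp].
      by rewrite inP pS.
    by exists (- x); rewrite ?opprK //= inP pS.
  - apply/fdisjointP => _ /imfsetP[y /= + ->]; rewrite !inU => /mapP[i _ ->].
    by apply/negP => /mapP[].
have := odd_double_half (lam - mu); rewrite -/m => def.
case: (boolP (odd (lam - mu))) def => odd_d /= def.
  exists (P `|` U `|` [fset 0])%fset, P, U; case: base => b1 b2.
  by do 2!split=> //; right; split=> //; rewrite szP -def add1n subn1.
exists (P `|` U)%fset, P, U; case: base => b1 b2.
by do 2!split=> //; left; split=> //; rewrite szP -def.
Qed.

Section SignedGraphs.

Variable V : finType.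
Implicit Types (S : signed_graph V) (Y : {set {set V}}) (A : {set V}).

Fact restrict_card2 S Y e : e \in edges S :&: Y -> #|e| = 2.
Proof. by case/setIP=> /edges_card2. Qed.

Fact restrict_pm1 S Y e : e \in edges S :&: Y -> sgn S e = 1 \/ sgn S e = -1.
Proof. by case/setIP=> /sgn_pm1. Qed.

(* The spanning signed subgraph with edge set Y, for Y a subset of edges S. *)
Definition restrict S Y : signed_graph V :=
  @SignedGraph V (edges S :&: Y) (sgn S)
    (@restrict_card2 S Y) (@restrict_pm1 S Y).

Definition adj S : rel V := [rel v w | [set v; w] \in edges S].

Definition components S : {set {set V}} :=
  [set [set w | connect (adj S) v w] | v : V].

(* The bound on the size excludes the walk v, w, v along a single edge. *)
Definition is_cycle S (s : seq V) : bool :=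
  [&& 2 < size s, cycle (adj S) s & uniq s]%N.

Definition cycle_edges (s : seq V) : {set {set V}} :=
  [set [set v; next s v] | v in s].

Definition negative_cycle S (s : seq V) : bool :=
  is_cycle S s && odd #|[set e in cycle_edges s | sgn S e == -1]|.

(* The subgraph of S induced on A has no negative cycle. A cycle has distinct
   vertices, so tuples of size at most #|V| suffice; see balanced_onP. *)
Definition balanced_on S A : bool :=
  [forall n : 'I_#|V|.+1, [forall s : n.-tuple V,
     [forall (v | v \in s), v \in A] ==> ~~ negative_cycle S s]].

Definition all_positive_on S A : bool :=
  [forall (e | e \in edges S), (e \subset A) ==> (sgn S e == 1)].

Definition ncomp S : nat := #|components S|.
Definition nbal S : nat := #|[set A in components S | balanced_on S A]|.
Definition npos S : nat := #|[set A in components S | all_positive_on S A]|.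

Lemma balanced_onP S A :
  reflect (forall s : seq V, {subset s <= A} -> ~~ negative_cycle S s)
          (balanced_on S A).
Proof.
apply: (iffP forallP) => [bal s sA | bal n].
  apply/negP => neg; have /andP[/and3P[_ _ us] _] := neg.
  have ltn : (size s < #|V|.+1)%N by rewrite ltnS -(card_uniqP us) max_card.
  have /forallP/(_ (in_tuple s))/implyP := bal (Ordinal ltn).
  have sA' : [forall (v | v \in in_tuple s), v \in A].
    by apply/forall_inP => v; apply: sA.
  by move/(_ sA'); rewrite neg.
by apply/forallP => s; apply/implyP => /forall_inP sA; apply: bal.
Qed.

Lemma nbal_le_ncomp S : (nbal S <= ncomp S)%N.
Proof. by apply/subset_leq_card/subsetP => A; rewrite inE => /andP[]. Qed.

Lemma npos_le_nbal S : (npos S <= nbal S)%N.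
Proof.
apply/subset_leq_card/subsetP => A; rewrite !inE => /andP[-> /forall_inP pos].
apply/balanced_onP => s sA; apply/negP => /andP[/and3P[_ cyc _]].
suff -> : [set e in cycle_edges s | sgn S e == -1] = set0 by rewrite cards0.
apply/setP => e; rewrite !inE; apply/negP => /andP[/imsetP[v vs ->] neg].
have ed : [set v; next s v] \in edges S by apply: (next_cycle cyc vs).
have /implyP := pos _ ed; rewrite subUset !sub1set !sA ?mem_next //.
by rewrite (eqP neg) => /(_ isT).
Qed.

Definition proper_colouring S (C : {fset int}) (k : {ffun V -> C}) : bool :=
  [forall v, forall w, ([set v; w] \in edges S) ==>
     (val (k v) != sgn S [set v; w] * val (k w))].

Definition num_colourings S (C : {fset int}) : nat :=
  #|[set k : {ffun V -> C} | proper_colouring S k]|.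

End SignedGraphs.

(* Main.v *)
(* Inclusion-exclusion over the set of violated edges (those with
   k v = sgn(vw) * k w) reduces the claim to counting, for each Y, the colourings
   violating every edge of Y.  Such a colouring is determined on each component by
   its value at a root, propagated along walks with the sign of the walk.  On an
   all-positive component any colour is allowed; on another balanced component the
   propagation is consistent (a closed walk decomposes into cycles and
   back-and-forth steps, hence is positive) but both signs of the root colour
   occur, so it must lie in C and -C; on an unbalanced component a negative cycle
   forces the colour 0. *)
Require Import Defs.
From mathcomp Require Import all_boot all_order all_algebra finmap zify.

Set Implicit Arguments.
Unset Strict Implicit.

Import Order.TTheory GRing.Theory Num.Theory.
Local Open Scope ring_scope.

(* [poly.root] would otherwise shadow the component representative. *)
Local Notation root := fingraph.root.
Local Notation rootP := fingraph.rootP.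

(** * Sequences and two-element sets *)

Lemma not_uniq_split (T : eqType) (s : seq T) :
  ~~ uniq s -> exists y a b c, s = a ++ y :: b ++ y :: c.
Proof.
elim: s => [|x s IHs] //=; rewrite negb_and negbK => /orP[xs | /IHs].
  by case/splitPr: xs => b c; exists x, [::], b, c.
by case=> y [a [b [c ->]]]; exists y, (x :: a), b, c.
Qed.

Lemma next_next_neq (T : eqType) (s : seq T) (v : T) :
  uniq s -> (2 < size s)%N -> v \in s -> next s (next s v) != v.
Proof.
move=> us s_gt2 /rot_to[i s' def_s].
rewrite -!(next_rot i us) def_s.
have := us; rewrite -(rot_uniq i) def_s.
have := s_gt2; rewrite -(size_rot i) def_s.
case: s' {def_s} => [|w [|z s']] //= _ /and3P[].
rewrite !inE !negb_or => /and3P[v_w v_z _] _ _.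
by rewrite eqxx [w == v]eq_sym (negPf v_w) eqxx eq_sym.
Qed.

Lemma set2_eq (T : finType) (a b c d : T) :
  [set a; b] = [set c; d] -> a = c /\ b = d \/ a = d /\ b = c.
Proof.
move=> eq_s.
have /set2P a_cd : a \in [set c; d] by rewrite -eq_s set21.
have /set2P b_cd : b \in [set c; d] by rewrite -eq_s set22.
have /set2P c_ab : c \in [set a; b] by rewrite eq_s set21.
have /set2P d_ab : d \in [set a; b] by rewrite eq_s set22.
by case: a_cd b_cd c_ab d_ab => -> [] -> [] ? [] ?; auto.
Qed.

(** * Parity of signed walks, balance and switching *)

Section SignedWalks.

Variables (V : finType) (S : signed_graph V).
Implicit Types (v w x y r : V) (p s : seq V) (A : {set V}).

Lemma adj_sym : symmetric (adj S).
Proof. by move=> v w; rewrite /adj /= setUC. Qed.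

Lemma adj_neq v w : adj S v w -> v != w.
Proof. by move/edges_card2; rewrite cards2; case: eqP. Qed.

(** Signs become boolean exponents of -1, so that multiplying signs along a walk is [(+)];
    meaningful only on edges. *)
Definition neg v w : bool := sgn S [set v; w] == -1.

Lemma negC v w : neg v w = neg w v.
Proof. by rewrite /neg setUC. Qed.

Lemma sgn_neg v w : adj S v w -> sgn S [set v; w] = (-1) ^+ neg v w.
Proof. by rewrite /neg => /sgn_pm1[] ->. Qed.

Fixpoint walk_parity x p : bool :=
  if p is y :: p' then neg x y (+) walk_parity y p' else false.

Lemma walk_parity_cat x p q :
  walk_parity x (p ++ q) = walk_parity x p (+) walk_parity (last x p) q.
Proof. by elim: p x => [|y p IHp] x //=; rewrite IHp addbA. Qed.

Lemma walk_parity_rev x p :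
  walk_parity (last x p) (rev (belast x p)) = walk_parity x p.
Proof.
elim: p x => [|y p IHp] x //=.
rewrite rev_cons -cats1 walk_parity_cat IHp /= addbF addbC negC.
by congr (neg _ _ (+) _); case: p {IHp} => //= z p; rewrite rev_cons last_rcons.
Qed.

Lemma walk_parity_next x p :
  uniq (x :: p) -> walk_parity x (rcons p x)
    = odd (\sum_(v <- x :: p) neg v (next (x :: p) v)).
Proof.
(* The closing vertex [z] is freed from the head: the induction changes the head, while [next_at]
   keeps [z] as successor of the last vertex. *)
suff closing z : uniq (x :: p) -> walk_parity x (rcons p z)
    = odd (\sum_(v <- x :: p) neg v (next_at v z x p)) by apply: closing.
elim: p x => [|y p IHp] x /=; first by rewrite big_seq1 eqxx addbF oddb.
case/andP=> x_p u_p; rewrite IHp // [in RHS]big_cons eqxx oddD oddb.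
congr (_ (+) odd _); rewrite !big_seq; apply: eq_bigr => v v_p.
by case: eqP => // v_x; rewrite -v_x v_p in x_p.
Qed.

(** The map sending [v] to the edge from [v] to its successor is injective: a collision would make
    some vertex its own second successor, impossible in length at least 3. *)
Lemma odd_cycle_edges x p : uniq (x :: p) -> (1 < size p)%N ->
  odd #|[set e in cycle_edges (x :: p) | sgn S e == -1]|
    = walk_parity x (rcons p x).
Proof.
move=> us p_gt1; rewrite walk_parity_next //; congr odd.
rewrite -sum1dep_card big_mkcondr /= big_imset /=; last first.
  move=> v w _ w_s /set2_eq[[] // | [-> w_v]].
  by case/eqP: (next_next_neq us p_gt1 w_s).
by rewrite big_uniq //=; apply: eq_bigr => v _; rewrite /neg; case: ifP.
Qed.

(* Induction on the length: a closed walk that repeats a vertex splits into two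
   shorter closed walks, and one without repetition is a cycle or has length at
   most 2. *)
Lemma balanced_closed_walk A x p :
  balanced_on S A -> {subset x :: p <= A} -> path (adj S) x p -> last x p = x ->
  walk_parity x p = false.
Proof.
move=> /balanced_onP balA; have [n] := ubnP (size p).
elim: n x p => // n IHn x p; case/lastP: p => // p y; rewrite last_rcons.
rewrite size_rcons ltnS => le_pn sA walk_p def_y; subst y.
have [us | /not_uniq_split[y [a [b [c def_s]]]]] := boolP (uniq (x :: p)).
  case: (ltnP 1 (size p)) => [p_gt1 | p_le1].
    apply/negbTE; rewrite -odd_cycle_edges //.
    have /balA : {subset x :: p <= A}.
      by move=> v v_s; apply: sA; rewrite -rcons_cons mem_rcons inE v_s orbT.
    rewrite /negative_cycle /is_cycle us [cycle _ _]walk_p.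
    by rewrite (p_gt1 : 2 < size (x :: p))%N.
  case: p p_le1 walk_p {le_pn sA us} => [|z []] //= _.
    by rewrite andbT => /adj_neq; rewrite eqxx.
  by rewrite negC addbF addbb.
(* If the repeated vertex is the start [x], the walk splits there into two closed walks. Otherwise
   the detour from [y] back to [y] is cut out, and what remains is glued at [y] into a closed walk
   at [x]. *)
case: a def_s => [|x' a] [def_x def_p].
  subst y; move: le_pn walk_p sA; rewrite def_p.
  rewrite rcons_cat /= -!cat_rcons cat_path size_cat size_rcons last_rcons.
  move=> le_n /andP[walk1 walk2] sA.
  rewrite walk_parity_cat last_rcons.
  rewrite (IHn x (rcons b x)) ?(IHn x (rcons c x)) ?last_rcons ?size_rcons //; try lia.
    move=> v; rewrite inE => /predU1P[-> | v_s]; apply: sA; first exact: mem_head.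
    by rewrite inE mem_cat v_s !orbT.
  by move=> v v_s; apply: sA; rewrite -cat_cons mem_cat v_s.
move: le_pn walk_p sA; rewrite def_p {x' def_x def_p}.
rewrite rcons_cat /= rcons_cat /= -!cat_rcons !cat_path !last_rcons.
rewrite !size_cat !size_rcons => le_n /and3P[walk1 walk2 walk3] sA.
rewrite !walk_parity_cat !last_rcons.
have -> : walk_parity y (rcons b y) = false.
  apply: IHn; rewrite ?last_rcons // ?size_rcons.
    by lia.
  move=> v; rewrite inE => /predU1P[-> | v_s]; apply: sA.
    by rewrite inE !mem_cat mem_rcons inE eqxx !orbT.
  by rewrite inE !mem_cat v_s !orbT.
rewrite /= -[y in walk_parity y (rcons c x)](last_rcons x a).
rewrite -walk_parity_cat IHn ?last_cat ?last_rcons //.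
- by rewrite size_cat !size_rcons; lia.
- move=> v; rewrite inE mem_cat => v_s; apply: sA; rewrite inE !mem_cat.
  by case/or3P: v_s => ->; rewrite ?orbT.
by rewrite cat_path walk1 last_rcons.
Qed.

Lemma walk_parity_positive A x p :
  all_positive_on S A -> {subset x :: p <= A} -> path (adj S) x p ->
  walk_parity x p = false.
Proof.
move=> /forall_inP posA; elim: p x => //= y p IHp x sA /andP[adj_xy walk_p].
rewrite IHp //; last by move=> v v_p; apply: sA; rewrite inE v_p orbT.
have /implyP := posA _ adj_xy; rewrite /neg subUset !sub1set.
by rewrite !sA ?inE ?eqxx ?orbT // => /(_ isT)/eqP ->.
Qed.

Lemma all_positive_balanced A : all_positive_on S A -> balanced_on S A.
Proof.
move=> posA; apply/balanced_onP => -[|x p] sA //.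
apply/negP => /andP[/and3P[p_gt1 walk_p us]]; rewrite odd_cycle_edges //.
rewrite (walk_parity_positive posA) // => v.
by rewrite inE mem_rcons orbA orbb; apply: sA.
Qed.

Definition component v : {set V} := [set w | connect (adj S) v w].

Lemma connectC : connect_sym (adj S).
Proof. exact/sym_connect_sym/adj_sym. Qed.

Lemma component_eq v w : connect (adj S) v w -> component v = component w.
Proof.
move=> vw; apply/setP => u; rewrite !inE.
by apply: (same_connect connectC).
Qed.

Lemma component_root v : component (root (adj S) v) = component v.
Proof. by apply: component_eq; rewrite connectC connect_root. Qed.

Lemma component_walk x p :
  path (adj S) x p -> {subset x :: p <= component x}.
Proof. by move=> walk_p v v_p; rewrite inE (path_connect walk_p). Qed.

Fact root_walk_ex v :
  exists p, path (adj S) (root (adj S) v) p && (last (root (adj S) v) p == v).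
Proof.
have: connect (adj S) (root (adj S) v) v by rewrite connectC connect_root.
by case/connectP => p walk_p def_v; exists p; rewrite walk_p -def_v /=.
Qed.

Definition root_walk v : seq V := xchoose (root_walk_ex v).

Lemma root_walkP v : path (adj S) (root (adj S) v) (root_walk v).
Proof. by case/andP: (xchooseP (root_walk_ex v)). Qed.

Lemma last_root_walk v : last (root (adj S) v) (root_walk v) = v.
Proof. by case/andP: (xchooseP (root_walk_ex v)) => _ /eqP. Qed.

(* Switching by this function makes every balanced component all-positive; its
   values on unbalanced components depend on the chosen walks and are junk. *)
Definition switch v : bool := walk_parity (root (adj S) v) (root_walk v).

Lemma switch_positive v : all_positive_on S (component v) -> switch v = false.
Proof.
rewrite -component_root => pos.
exact: walk_parity_positive pos (component_walk (root_walkP v)) (root_walkP v).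
Qed.

(** The walk chosen for a root need not be empty, but it is closed, so balance makes it positive. *)
Lemma switch_root v :
  balanced_on S (component v) -> switch (root (adj S) v) = false.
Proof.
set r := root (adj S) v; have rr : root (adj S) r = r by apply: root_root connectC _.
have := root_walkP r; have := last_root_walk r; rewrite /switch rr => lastr walkr.
rewrite -component_root => bal.
exact: balanced_closed_walk bal (component_walk walkr) walkr lastr.
Qed.

(** The root walk to [v], the edge to [w] and the reversed root walk of [w] form a closed walk,
    positive by balance. *)
Lemma switch_adj v w : balanced_on S (component v) -> adj S v w ->
  neg v w = switch v (+) switch w.
Proof.
move=> bal adj_vw.
have eq_r : root (adj S) w = root (adj S) v.
  by apply/esym/(rootP connectC)/connect1.
set r := root (adj S) v in eq_r; set p := root_walk v; set q := root_walk w.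
have walk_p : path (adj S) r p by apply: root_walkP.
have last_p : last r p = v by apply: last_root_walk.
have walk_q : path (adj S) r q by rewrite -eq_r; apply: root_walkP.
have last_q : last r q = w by rewrite -eq_r; apply: last_root_walk.
have walk_c : path (adj S) r (p ++ w :: rev (belast r q)).
  rewrite cat_path walk_p last_p /= adj_vw /= -last_q rev_path.
  by rewrite (eq_path (e' := adj S)) // => x y; apply: adj_sym.
have last_c : last r (p ++ w :: rev (belast r q)) = r.
  by rewrite last_cat /= -last_q; case: (q) => //= y q'; rewrite rev_cons last_rcons.
rewrite -component_root -/r in bal.
have := balanced_closed_walk bal (component_walk walk_c) walk_c last_c.
rewrite walk_parity_cat last_p /= -{2}last_q walk_parity_rev.
rewrite /switch eq_r -/r -/p -/q.
by case: (neg v w); case: (walk_parity r p); case: (walk_parity r q).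
Qed.

End SignedWalks.

(** * Counting the colourings that violate every edge *)

Section Violations.

Variables (V : finType) (S : signed_graph V) (C : {fset int}).
Implicit Types (k : {ffun V -> C}) (v w : V).

Definition all_violated k : bool :=
  [forall v, forall w, adj S v w ==>
     (val (k v) == sgn S [set v; w] * val (k w))].

Lemma all_violatedP k :
  reflect (forall v w, adj S v w -> val (k v) = (-1) ^+ neg S v w * val (k w))
          (all_violated k).
Proof.
apply: (iffP idP) => [viol v w adj_vw | viol].
  have /forallP/(_ v)/forallP/(_ w)/implyP/(_ adj_vw)/eqP := viol.
  by rewrite sgn_neg.
apply/forallP => v; apply/forallP => w; apply/implyP => adj_vw.
by rewrite (viol _ _ adj_vw) sgn_neg.
Qed.

Lemma all_violated_walk k x p : all_violated k -> path (adj S) x p ->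
  val (k x) = (-1) ^+ walk_parity S x p * val (k (last x p)).
Proof.
move/all_violatedP => viol; elim: p x => [|y p IHp] x /=; first by rewrite mul1r.
by case/andP=> /viol -> /IHp ->; rewrite mulrA signr_addb.
Qed.

(** Going once around a negative cycle gives [k x = - k x]; the colour 0 then propagates to [v]. *)
Lemma all_violated_unbalanced k v :
  all_violated k -> ~~ balanced_on S (component S v) -> val (k v) = 0.
Proof.
move=> viol; case/forallPn => n /forallPn[s]; rewrite negb_imply negbK.
case/andP=> /forall_inP sA /andP[/and3P[s_gt2 cyc us] neg_s].
have {}sA : {subset tval s <= component S v} by move=> u; apply: sA.
case: (tval s) s_gt2 cyc us neg_s sA => [|x p] //= p_gt1 walk_p us.
rewrite odd_cycle_edges // => odd_p sA.
have := all_violated_walk viol walk_p; rewrite odd_p last_rcons mulN1r.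
move=> kx; have {kx} kx : val (k x) = 0 by lia.
have := sA _ (mem_head _ _); rewrite inE => /connectP[q walk_q def_x].
by rewrite (all_violated_walk viol walk_q) -def_x kx mulr0.
Qed.

Lemma all_violated_root k v : all_violated k ->
  val (k v) = (-1) ^+ switch S v * val (k (root (adj S) v)).
Proof.
move=> viol; have := all_violated_walk viol (root_walkP S v).
by rewrite last_root_walk /switch => ->; rewrite signrMK.
Qed.

(* The colours that the root of a component with vertex set A can take when all
   edges are violated: the other vertices then carry plus or minus that colour,
   both signs occur unless A is all-positive, and a negative cycle forces 0. *)
Definition root_colours (A : {set V}) : pred C :=
  if all_positive_on S A then predT
  else if balanced_on S A then [pred x : C | - val x \in C]
  else [pred x : C | val x == 0].

Lemma all_violated_root_colours k v : all_violated k ->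
  root_colours (component S v) (k (root (adj S) v)).
Proof.
move=> viol; rewrite /root_colours; case: ifPn => // not_pos.
case: ifPn => [bal | unbal] /=; last first.
  by rewrite all_violated_unbalanced // component_root.
(* The endpoints of a negative edge have different [switch] values, so one of them carries the
   negative of the root colour; that negative therefore lies in [C]. *)
have [w /andP[vw sw]] : exists w, connect (adj S) v w && switch S w.
  case/forall_inPn: not_pos => e e_S; rewrite negb_imply => /andP[sub_e neg_e].
  have /eqP/cards2P[x [y [x_y def_e]]] := edges_card2 e_S.
  move: e_S sub_e neg_e; rewrite {}def_e => e_S.
  rewrite subUset !sub1set !inE => /andP[vx vy] neg_e.
  have : neg S x y by rewrite /neg; case: (sgn_pm1 e_S) neg_e => ->.
  rewrite switch_adj -?(component_eq vx) //.
  have [sx _ | _ sy] := boolP (switch S x); first by exists x; rewrite vx.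
  by exists y; rewrite vy.
have := all_violated_root w viol; rewrite sw mulN1r.
have -> : root (adj S) w = root (adj S) v by apply/esym/(rootP (connectC S)).
by move <-; apply: valP.
Qed.

(** Restriction to the roots is injective on these colourings, and its image consists of all
    independent choices of allowed root colours. *)
Lemma card_all_violated :
  #|[set k | all_violated k]| = \prod_(A in components S) #|root_colours A| :> nat.
Proof.
pose rt := root (adj S); pose T := {r | r \in roots (adj S)}.
have symc := connectC S.
pose restr k : {ffun T -> C} := [ffun r => k (val r)].
have inj_restr : {in [set k | all_violated k] &, injective restr}.
  move=> k1 k2; rewrite !inE => v1 v2 /ffunP eq_k; apply/ffunP => v; apply: val_inj.
  rewrite (all_violated_root _ v1) (all_violated_root _ v2).
  by have := eq_k (Sub (rt v) (roots_root symc v)); rewrite !ffunE /= => ->.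
rewrite -(card_in_imset inj_restr).
pose F (r : T) := root_colours (component S (val r)).
have -> : #|restr @: [set k | all_violated k]| = #|family F|.
  apply: eq_card => g; apply/imsetP/familyP => [[k] | Fg].
    rewrite inE => viol -> r; rewrite ffunE unfold_in /F.
    by have := all_violated_root_colours (val r) viol; rewrite (eqP (valP r)).
  pose gr v := g (Sub (rt v) (roots_root symc v)).
  have Fgr v : root_colours (component S v) (gr v).
    by have := Fg (Sub (rt v) (roots_root symc v)); rewrite unfold_in /F /= component_root.
  (* The default [gr v] of [insubd] never matters: where [switch] is true the component is not
     all-positive, so the allowed colours have their negatives in [C]. *)
  pose k : {ffun V -> C} :=
    [ffun v => insubd (gr v) ((-1) ^+ switch S v * val (gr v))].
  have kE v : val (k v) = (-1) ^+ switch S v * val (gr v).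
    rewrite ffunE val_insubd; case: ifPn => // /negP[].
    case sv: (switch S v); last by rewrite mul1r; apply: valP.
    rewrite mulN1r; have := Fgr v; rewrite /root_colours.
    case: ifPn => [/switch_positive|_]; first by rewrite sv.
    case: ifPn => //= _ /eqP gr0; rewrite gr0 oppr0 -gr0; apply: valP.
  have gr0 v : ~~ balanced_on S (component S v) -> val (gr v) = 0.
    move=> unbal; have := Fgr v; rewrite /root_colours (negPf unbal).
    by case: ifPn => [/all_positive_balanced/(negP unbal) | _ /eqP].
  have eq_gr v w : rt v = rt w -> gr v = gr w.
    by move=> eq_rt; congr (g _); apply: val_inj.
  exists k.
    rewrite inE; apply/all_violatedP => v w adj_vw; rewrite !kE.
    have -> : gr w = gr v by apply/esym/eq_gr/(rootP symc)/connect1.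
    have [bal | unbal] := boolP (balanced_on S (component S v)).
      by rewrite switch_adj // signr_addb -!mulrA signrMK.
    by rewrite gr0 // !mulr0.
  apply/ffunP => r; apply: val_inj; rewrite ffunE kE.
  have def_r : Sub (rt (val r)) (roots_root symc (val r)) = r.
    by apply: val_inj; apply/eqP; apply: (valP r).
  have -> : g r = gr (val r) by rewrite /gr def_r.
  have [bal | unbal] := boolP (balanced_on S (component S (val r))).
    by have := switch_root bal; rewrite (eqP (valP r)) => ->; rewrite mul1r.
  by rewrite gr0 // mulr0.
have -> : components S = component S @: roots (adj S).
  apply/setP => A; apply/imsetP/imsetP => -[v v_r ->]; last by exists v.
  by exists (rt v); [apply: roots_root | rewrite component_root].
rewrite big_imset; last first.
  move=> r1 r2 /eqP <- /eqP <- /setP/(_ (root (adj S) r2)).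
  rewrite !component_root !inE connect_root => /(rootP symc).
  by rewrite (root_root symc).
rewrite big_sub card_family foldrE big_map big_enum.
exact: eq_bigr.
Qed.

End Violations.

(** * Sizes of a colour set and of its symmetric and zero parts *)

Lemma card_fset_pred (K : choiceType) (C : {fset K}) (p : pred K) :
  #|[pred x : C | p (val x)]| = #|` [fset x in C | p x]%fset|.
Proof. by rewrite card_fset_sum1 -big_fset_condE big_seq_fsetE -sum1_card. Qed.

Section ColourSets.

Variables (lam mu : nat) (C : {fset int}).
Hypotheses (le_mu_lam : (mu <= lam)%N) (colC : colour_set lam mu C).

Lemma card_colour_set : #|` C| = lam.
Proof.
have [P [U [[dPU P0 U0] [[_ cU _] defC]]]] := colC.
have cPU : #|` P `|` U|%fset = (#|` P| + mu)%N by rewrite cardfsU (eqP dPU) cardfs0 subn0 cU.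
case: defC => -[odd_d cP ->]; rewrite ?cPU ?cP ?subnK //.
rewrite fsetUC cardfsU1 cPU cP !inE negb_or P0 U0 /=.
(* Oddness makes [lam - mu] positive, so the truncated predecessor loses nothing. *)
by move: odd_d; case: (lam - mu)%N (subnK le_mu_lam) => // d; lia.
Qed.

(** The symmetric part of [C] is [P], with 0 added in the odd case: the negative of an element of
    [U] is nonzero, outside [U], and outside [P] because [P] is symmetric and disjoint from [U]. *)
Lemma card_symmetric_colours :
  #|` [fset x in C | - x \in C]%fset| = (lam - mu)%N.
Proof.
have [P [U [[dPU P0 U0] [[symP cU dU] defC]]]] := colC.
have oppP x : (- x \in P) = (x \in P).
  rewrite -{1}symP; apply/imfsetP/idP => [[y /= yP /oppr_inj ->] //|xP].
  by exists x.
have oppU x : x \in U -> - x \notin U.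
  by move=> xU; apply: (fdisjointP dU); apply/imfsetP; exists x.
case: defC => -[odd_d cP ->].
  rewrite -cP; congr #|` _|; apply/fsetP => x; rewrite !inE oppP.
  have [xP | _] //= := boolP (x \in P).
  by have [xU | //] := boolP (x \in U); rewrite (negPf (oppU x xU)).
suff -> : [fset x in P `|` U `|` [fset 0] | - x \in P `|` U `|` [fset 0]]%fset = (0 |` P)%fset.
  by rewrite cardfsU1 P0 cP; move: odd_d; case: (lam - mu)%N => // d; lia.
apply/fsetP => x; rewrite !inE oppP oppr_eq0 [RHS]orbC.
have [xP | _] //= := boolP (x \in P).
have [-> | x0] := eqVneq x 0; first by rewrite !orbT.
rewrite !orbF /=.
by have [xU | //] := boolP (x \in U); rewrite (negPf (oppU x xU)).
Qed.

Lemma card_zero_colours :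
  #|` [fset x in C | x == 0]%fset| = ((lam - mu) %% 2)%N.
Proof.
have [P [U [[dPU P0 U0] [_ defC]]]] := colC.
case: defC => -[odd_d _ ->]; rewrite modn2 ?odd_d ?(negPf odd_d).
  apply/eqP; rewrite cardfs_eq0; apply/eqP/fsetP => x; rewrite !inE.
  by have [-> | _] := eqVneq x 0; rewrite ?andbF // (negPf P0) (negPf U0).
rewrite -[RHS](cardfs1 (0 : int)); congr #|` _|; apply/fsetP => x; rewrite !inE.
by have [-> | _] := eqVneq x 0; rewrite ?andbF ?orbT.
Qed.

Lemma card_all_violated_colour_set (V : finType) (S : signed_graph V) :
  #|[set k : {ffun V -> C} | all_violated S k]| =
    (lam ^ npos S * (lam - mu) ^ (nbal S - npos S)
      * ((lam - mu) %% 2) ^ (ncomp S - nbal S))%N.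
Proof.
rewrite card_all_violated.
(* The product splits along [Pos], the rest of [Bal], and the unbalanced components, on each of
   which the number of root colours is constant. *)
pose Bal := [set A in components S | balanced_on S A].
pose Pos := [set A in components S | all_positive_on S A].
have subBal : Bal \subset components S by apply/subsetP => A; rewrite inE => /andP[].
have subPos : Pos \subset Bal.
  by apply/subsetP => A; rewrite !inE => /andP[-> /all_positive_balanced].
rewrite (big_setID Bal) (setIidPr subBal) (big_setID Pos) (setIidPr subPos) /=.
rewrite (eq_bigr (fun=> lam)); last first.
  by move=> A; rewrite inE /root_colours => /andP[_ ->]; rewrite -cardfE card_colour_set.
rewrite prod_nat_const -/Pos.
rewrite (eq_bigr (fun=> lam - mu)%N); last first.
  move=> A; rewrite !inE /root_colours => /andP[/nandP notPos /andP[compA ->]].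
  case: ifPn notPos => [_ [] | _ _]; rewrite ?compA //.
  by rewrite (card_fset_pred C (fun x => - x \in C)) card_symmetric_colours.
rewrite prod_nat_const cardsDS //.
rewrite (eq_bigr (fun=> (lam - mu) %% 2)%N); last first.
  move=> A; rewrite !inE /root_colours => /andP[/nandP notBal compA].
  have {notBal} notBal : ~~ balanced_on S A by case: notBal; rewrite ?compA.
  rewrite (negPf notBal) (negPf (contra (@all_positive_balanced _ _ _) notBal)).
  by rewrite (card_fset_pred C (fun x => x == 0)) card_zero_colours.
by rewrite prod_nat_const cardsDS.
Qed.

End ColourSets.

(** * Inclusion-exclusion over the violated edges *)

Lemma sum_sign_subsets (T : finType) (B : {set T}) :
  \sum_(Y : {set T} | Y \subset B) (-1) ^+ #|Y| = (B == set0)%:Z.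
Proof.
(* Expanding this product, the term choosing the first summand exactly on [Y] is the sign of [Y] if
   [Y] lies in [B] and 0 otherwise. Any element of [B] gives a zero factor. *)
transitivity (\prod_(i : T) (- (i \in B)%:Z + 1)).
  rewrite bigA_distr big_mkcond; apply: eq_bigr => Y _.
  rewrite -big_mkcond /=; case: ifPn => [/subsetP YB | /subsetPn[i iY iB]].
    by rewrite -prodr_const; apply: eq_bigr => i /YB ->.
  by rewrite (bigD1 i) //= (negPf iB) oppr0 mul0r.
have [-> | [i iB]] := set_0Vmem B.
  by rewrite eqxx big1 // => i _; rewrite inE.
rewrite (bigD1 i) //= iB addNr mul0r.
by case: eqP iB => // ->; rewrite inE.
Qed.

Section BadEdges.

Variables (V : finType) (S : signed_graph V) (C : {fset int}).
Implicit Types (k : {ffun V -> C}) (Y : {set {set V}}).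

(** Both orderings of the endpoints are tested; since signs are 1 or -1, either equation implies the
    other. *)
Definition bad_edges k : {set {set V}} :=
  [set e in edges S | [forall v, forall w, (e == [set v; w]) ==>
     (val (k v) == sgn S e * val (k w))]].

Lemma all_violated_restrict k Y : Y \subset edges S ->
  all_violated (restrict S Y) k = (Y \subset bad_edges k).
Proof.
move=> /subsetP YE; apply/idP/subsetP => [viol e eY | YB].
  rewrite inE (YE e eY) /=; apply/forallP => v; apply/forallP => w.
  apply/implyP => /eqP def_e; subst e.
  have /forallP/(_ v)/forallP/(_ w)/implyP := viol; apply.
  by rewrite /adj /= inE eY YE.
apply/forallP => v; apply/forallP => w; apply/implyP; rewrite /adj /= inE.
case/andP=> _ /YB; rewrite inE => /andP[_ /forallP/(_ v)/forallP/(_ w)].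
by rewrite eqxx.
Qed.

Lemma proper_colouring_bad k : proper_colouring S k = (bad_edges k == set0).
Proof.
apply/idP/eqP => [prop | bad0].
  apply/setP => e; rewrite [RHS]inE; apply/negP; rewrite inE.
  case/andP=> eE bad_e; have /eqP/cards2P[v [w [_ def_e]]] := edges_card2 eE.
  have /forallP/(_ v)/forallP/(_ w)/implyP := prop; rewrite -def_e => /(_ eE).
  by have /forallP/(_ v)/forallP/(_ w) := bad_e; rewrite def_e eqxx /= => ->.
apply/forallP => v; apply/forallP => w; apply/implyP => vwE; apply/negP => /eqP kv.
suff: [set v; w] \in bad_edges k by rewrite bad0 inE.
rewrite inE vwE; apply/forallP => x; apply/forallP => y; apply/implyP => /eqP.
case/set2_eq=> -[<- <-]; first by rewrite kv.
by rewrite kv mulrA; case: (sgn_pm1 vwE) => ->; rewrite ?mulrNN !mul1r.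
Qed.

End BadEdges.

Unset Implicit Arguments.

Theorem theorem4p4 (V : finType) (S : signed_graph V) (lam mu : nat)
    (le_mu_lam : (mu <= lam)%N) (C : {fset int}) (colC : colour_set lam mu C) :
  (num_colourings S C)%:Z =
    \sum_(0 <= i < #|edges S|.+1) (-1) ^+ i *
      \sum_(Y : {set {set V}} | (Y \subset edges S) && (#|Y| == i))
        lam%:Z ^+ npos (restrict S Y)
        * (lam%:Z - mu%:Z) ^+ (nbal (restrict S Y) - npos (restrict S Y))
        * ((lam - mu) %% 2)%:Z ^+ (ncomp (restrict S Y) - nbal (restrict S Y)).
Proof.
pose g Y := #|[set k : {ffun V -> C} | all_violated (restrict S Y) k]|.
transitivity (\sum_(Y : {set {set V}} | Y \subset edges S) (-1) ^+ #|Y| * (g Y)%:Z).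
  (* For fixed [k], the signed sum over subsets of its bad edges is 1 if [k] is proper and 0
     otherwise; exchanging the sums then produces [g Y]. *)
  transitivity (\sum_(k : {ffun V -> C}) \sum_(Y : {set {set V}} | Y \subset edges S)
      (-1) ^+ #|Y| * (all_violated (restrict S Y) k)%:Z).
    rewrite /num_colourings -sum1dep_card big_mkcond -natz natr_sum.
    apply: eq_bigr => k _; rewrite proper_colouring_bad.
    rewrite (_ : _%:R = (bad_edges S k == set0)%:Z); last by case: eqP.
    rewrite -sum_sign_subsets big_mkcond [RHS]big_mkcond; apply: eq_bigr => Y _.
    have [YE | notYE] := boolP (Y \subset edges S).
      by rewrite all_violated_restrict //; case: ifP; rewrite ?mulr1 ?mulr0.
    case: ifP => // YB; case/negP: notYE; apply: subset_trans YB _.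
    by apply/subsetP => e; rewrite inE => /andP[].
  rewrite exchange_big; apply: eq_bigr => Y _; rewrite -mulr_sumr; congr (_ * _).
  rewrite /g -sum1dep_card [in RHS]big_mkcond -[RHS]natz natr_sum.
  by apply: eq_bigr => k _; case: ifP.
(* Grouping by size; [inord] is exact since subsets of [edges S] have at most [#|edges S|]
   elements. *)
pose sz Y : 'I_#|edges S|.+1 := inord #|Y : {set {set V}}|.
rewrite big_mkord (partition_big sz predT) //=; apply: eq_bigr => i _.
rewrite mulr_sumr; apply: eq_big => Y.
  have [YE | //] /= := boolP (Y \subset edges S).
  by rewrite -val_eqE /= inordK // ltnS subset_leq_card.
case/andP=> YE /eqP <-; rewrite inordK ?ltnS ?subset_leq_card //.
rewrite /g (card_all_violated_colour_set le_mu_lam colC) !PoszM.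
by rewrite subzn // -!natz !natrX.
Qed.
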